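(* In the switched linear-quadratic setting, for every $t\in\{0,\dots,T\}$ denote by $(V_t^k)_{k\in\mathbb N}$ the sequence of functions generated by the Tropical Dynamic Programming algorithm with the min-plus selection functions $\phi_t^{\mathrm{min\text{-}plus}}$ and the draws made uniformly (and independently) over the unit Euclidean sphere $\mathbf S$ of $\mathbb X$. Then the sequence $(V_t^k)_{k\in\mathbb N}$ is non-increasing, bounded from below by $V_t$, and converges uniformly on $\mathbf S$ to a function $V_t^*$. Moreover, almost surely over the draws, $V_t^*=V_t$ on $\mathbf S$.
   Context: **Problem and assumptions (switched linear-quadratic setting).** $\mathbb X=\mathbb R^n$, $\mathbb U=\mathbb R^m$, $\mathbb V$ a finite set of discrete controls, $T$ a positive integer. For each $t\in\{0,\dots,T-1\}$ and $v\in\mathbb V$: $f_t^v(x,u)=A_t^vx+B_t^vu$ is linear; $c_t^v(x,u)=x^TC_t^vx+u^TD_t^vu$ with $C_t^v$ symmetric positive semidefinite and $D_t^v$ symmetric positive definite. The final cost is $\psi=\inf_{i\in I_T}\psi_i$, $I_T$ finite, $\psi_i(x)=x^TM_ix$ with $M_i$ symmetric and $0\preceq M_i\preceq\alpha_T\mathrm{Id}$ for all $i\in I_T$, for some constant $\alpha_T\ge0$ ($\preceq$ is the Loewner order). The value functions are $V_T=\psi$ and, for $t<T$, $V_t(x)=\inf_{v\in\mathbb V}\inf_{u\in\mathbb U}\big(c_t^v(x,u)+V_{t+1}(f_t^v(x,u))\big)$. **Operators.** For a convex pure quadratic form $\phi(x)=x^TMx$, $M\succeq0$, and $v\in\mathbb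 V$, $\mathcal B_t^v(\phi)(x):=\inf_{u\in\mathbb U}\big(c_t^v(x,u)+\phi(f_t^v(x,u))\big)$, which is again a convex pure quadratic form. **Min-plus selection functions.** For $t<T$, a finite non-empty set $F$ of convex pure quadratic forms and $x\in\mathbb X$, $\phi_t^{\mathrm{min\text{-}plus}}(F,x):=\mathcal B_t^v(\phi)$ for some $(v,\phi)\in\arg\min_{(v,\phi)\in\mathbb V\times F}\mathcal B_t^v(\phi)(x)$. For $t=T$, $\phi_T^{\mathrm{min\text{-}plus}}(F,x):=\psi_i$ for some $i\in\arg\min_{i\in I_T}\psi_i(x)$. **Algorithm.** $F_t^0=\emptyset$ for all $t\in\{0,\dots,T\}$. At iteration $k=0,1,\dots$: draw trial points $x^k=(x_0^k,\dots,x_T^k)$ from the uniform probability measure on $\mathbf S^{T+1}$, independently of the past; set $F_T^{k+1}=F_T^k\cup\{\phi_T^{\mathrm{min\text{-}plus}}(F_T^k,x_T^k)\}$, and for $t=T-1,\dots,0$ set $F_t^{k+1}=F_t^k\cup\{\phi_t^{\mathrm{min\text{-}plus}}(F_{t+1}^{k+1},x_t^k)\}$. The approximations are $V_t^k:=\inf_{\phi\in F_t^k}\phi$ (so $V_t^0\equiv+\infty$). *)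

(* Defs.v *)
From HB Require Import structures.
From mathcomp Require Import all_boot all_order all_algebra.
From mathcomp Require Import all_classical all_reals all_analysis.

Set Implicit Arguments.
Unset Strict Implicit.
Unset Printing Implicit Defensive.

Import Order.TTheory GRing.Theory Num.Theory.
Import numFieldNormedType.Exports.

Local Open Scope classical_set_scope.
Local Open Scope ring_scope.
Local Open Scope ereal_scope.

Section QuadraticForms.
Context {R : realType} {n : nat}.
Implicit Types (M : 'M[R]_n) (x : 'cV[R]_n).

Definition qform M x : R := (x^T *m M *m x) ord0 ord0.

Definition sympsd M : Prop :=
  (M^T = M /\ forall x, 0 <= qform M x)%R.

Definition sympd M : Prop :=
  (M^T = M /\ forall x, x != 0 -> 0 < qform M x)%R.

Definition loewner_le M N : Prop := sympsd (N - M)%R.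

(* Functions on R^n are extended-real valued, since value functions and the
   infimum over the empty set of forms must make sense. *)
Definition convex_pqf (phi : 'cV[R]_n -> \bar R) : Prop :=
  exists2 M, sympsd M & phi = (fun x => (qform M x)%:E).

(* The sphere is Euclidean, whereas the library norm on 'cV[R]_n is the sup
   norm (only its topology is used below). *)
Definition sphere : set 'cV[R]_n :=
  [set x | (\sum_(i < n) x i ord0 ^+ 2)%R = 1%R].

End QuadraticForms.

Arguments sphere R n : clear implicits.

(* Times range over nat; only the data at times t < horizon matter. *)
Record switched_lq (R : realType) (n m : nat) (V I : finType) := SwitchedLQ {
  horizon : nat ;
  dynA : nat -> V -> 'M[R]_n ;
  dynB : nat -> V -> 'M[R]_(n, m) ;
  costC : nat -> V -> 'M[R]_n ;
  costD : nat -> V -> 'M[R]_m ;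
  finalM : I -> 'M[R]_n ;
  alpha : R ;
  horizon_gt0 : (0 < horizon)%N ;
  costC_psd : forall t v, (t < horizon)%N -> sympsd (costC t v) ;
  costD_pd : forall t v, (t < horizon)%N -> sympd (costD t v) ;
  alpha_ge0 : (0 <= alpha)%R ;
  finalM_sym : forall i, ((finalM i)^T = finalM i)%R ;
  finalM_ge0 : forall i, loewner_le 0%R (finalM i) ;
  finalM_le : forall i, loewner_le (finalM i) (alpha%:M)%R
}.

Section TropicalDynamicProgramming.
Context {R : realType} {n m : nat} {V I : finType}.
Variable pb : switched_lq R n m V I.
Notation X := 'cV[R]_n.
Notation U := 'cV[R]_m.
Notation T := (horizon pb).

Definition dyn (t : nat) (v : V) (x : X) (u : U) : X :=
  (dynA pb t v *m x + dynB pb t v *m u)%R.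

Definition cost (t : nat) (v : V) (x : X) (u : U) : R :=
  (qform (costC pb t v) x + qform (costD pb t v) u)%R.

Definition final_form (i : I) (x : X) : \bar R := (qform (finalM pb i) x)%:E.

Definition final_cost (x : X) : \bar R :=
  ereal_inf [set final_form i x | i in [set: I]].

Definition bellman (t : nat) (v : V) (phi : X -> \bar R) (x : X) : \bar R :=
  ereal_inf [set (cost t v x u)%:E + phi (dyn t v x u) | u in [set: U]].

(* value_togo s is the value function at time T - s. *)
Fixpoint value_togo (s : nat) : X -> \bar R :=
  if s is s'.+1 then
    fun x => ereal_inf
      [set bellman (T - s) v (value_togo s') x | v in [set: V]]
  else final_cost.

Definition value (t : nat) : X -> \bar R := value_togo (T - t).

Lemma value_final : value T = final_cost.
Proof. by rewrite /value subnn. Qed.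

Lemma value_step t : (t < T)%N -> value t =
  (fun x => ereal_inf [set bellman t v (value t.+1) x | v in [set: V]]).
Proof.
move=> tT; rewrite /value -(subnSK tT) /=.
by rewrite (subnSK tT) subKn // ltnW.
Qed.

(* A selection function with an arbitrary rule for breaking ties in the
   argmin. At the final time the set of forms is irrelevant and may be
   empty. *)
Definition minplus_selection
    (sel : nat -> set (X -> \bar R) -> X -> (X -> \bar R)) : Prop :=
  (forall (t : nat) (F : set (X -> \bar R)) (x : X), (t < T)%N ->
     finite_set F -> F !=set0 -> F `<=` convex_pqf ->
     exists (v : V) (phi : X -> \bar R),
       [/\ F phi, sel t F x = bellman t v phi &
           forall (v' : V) (phi' : X -> \bar R), F phi' ->
             bellman t v phi x <= bellman t v' phi' x]) /\
  (forall (F : set (X -> \bar R)) (x : X),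
     finite_set F -> F `<=` convex_pqf ->
     exists i : I, sel T F x = final_form i /\
       forall i' : I, final_form i x <= final_form i' x).

Variable sel : nat -> set (X -> \bar R) -> X -> (X -> \bar R).

(* One iteration from the sets F with trial points x: the result for s is the
   new set at time T - s, computed from the new set at time T - s + 1. *)
Fixpoint tdp_backward (F : nat -> set (X -> \bar R)) (x : nat -> X)
    (s : nat) : set (X -> \bar R) :=
  if s is s'.+1 then
    F (T - s)%N `|` [set sel (T - s)%N (tdp_backward F x s') (x (T - s)%N)]
  else F T `|` [set sel T (F T) (x T)].

(* x k t is the trial point x_t^k and tdp_forms x k t the set F_t^k. *)
Fixpoint tdp_forms (x : nat -> nat -> X) (k t : nat) : set (X -> \bar R) :=
  if k is k'.+1 then tdp_backward (tdp_forms x k') (x k') (T - t)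
  else set0.

Lemma tdp_forms_final x k :
  tdp_forms x k.+1 T = tdp_forms x k T `|` [set sel T (tdp_forms x k T) (x k T)].
Proof. by rewrite /= subnn. Qed.

Lemma tdp_forms_step x k t : (t < T)%N ->
  tdp_forms x k.+1 t =
  tdp_forms x k t `|` [set sel t (tdp_forms x k.+1 t.+1) (x k t)].
Proof.
move=> tT /=; rewrite -(subnSK tT) /=.
by rewrite (subnSK tT) subKn // ltnW.
Qed.

Definition tdp_value (x : nat -> nat -> X) (k t : nat) (y : X) : \bar R :=
  ereal_inf [set phi y | phi in tdp_forms x k t].

End TropicalDynamicProgramming.

(* R^n with its Borel sigma-algebra. *)
Notation borelX R n := (g_sigma_algebraType (@open 'cV[R]_n)).

(* The uniform probability measure on the sphere is the (unique) Borel
   probability measure carried by it that is invariant under the orthogonal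
   group. *)
Definition uniform_on_sphere (R : realType) (n : nat)
    (sigma : probability (borelX R n) R) : Prop :=
  sigma (sphere R n) = 1 /\
  forall Q : 'M[R]_n, (Q^T *m Q = 1%:M)%R ->
  forall E : set (borelX R n), measurable E ->
    sigma [set x : 'cV[R]_n | E (Q *m x)%R] = sigma E.

Definition mutually_independent d d' (Omega : measurableType d)
    (S : measurableType d') (R : realType) (P : probability Omega R)
    (J : eqType) (Y : J -> Omega -> S) : Prop :=
  forall (s : seq J) (E : J -> set S), uniq s ->
    (forall j, measurable (E j)) ->
    P (\bigcap_(j in [set` s]) (Y j @^-1` E j)) =
    \prod_(j <- s) P (Y j @^-1` E j).

(* The uniform measure on the (T+1)-fold product of the sphere is the product
   of the uniform measures, so independent draws from it amount to mutual
   independence of all the points, over both iterations and times t <= T. *)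
Definition iid_draws d (Omega : measurableType d) (R : realType) (n T : nat)
    (P : probability Omega R) (sigma : probability (borelX R n) R)
    (x : nat -> nat -> Omega -> 'cV[R]_n) : Prop :=
  [/\ forall k t, (t <= T)%N ->
        measurable_fun [set: Omega] (x k t : Omega -> borelX R n),
      forall k t, (t <= T)%N -> forall E : set (borelX R n), measurable E ->
        P (x k t @^-1` E) = sigma E &
      mutually_independent P
        (fun j : nat * 'I_T.+1 => x j.1 j.2 : Omega -> borelX R n)].

(* For extended-real valued functions f k; the bound forces f k to be finite
   on S for k large. *)
Definition cvg_uniformly_on (R : realType) (Y : Type) (S : set Y)
    (f : nat -> Y -> \bar R) (g : Y -> R) : Prop :=
  forall e : R, (0 < e)%R ->
    \forall k \near \oo, forall y, S y -> `|f k y - (g y)%:E| < e%:E.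

(* Main.v *)
Require Import Defs.
From HB Require Import structures.
From mathcomp Require Import all_boot all_order all_algebra.
From mathcomp Require Import all_classical all_reals all_analysis.
From mathcomp Require Import ring lra.

(** The Bellman operators send convex pure quadratic forms to such forms (Schur
    complement) and preserve uniform Loewner bounds, so at each time all the
    forms produced by the algorithm satisfy [0 <= M <= a Id] with [a]
    independent of the iteration ([tdp_forms_bounded]). They are therefore
    equicontinuous, and their running infimum, which decreases, converges
    uniformly on the compact sphere to the infimum of all the forms ever
    produced ([cvg_uniformly_envelope]). Monotonicity of the Bellman operators
    keeps every form above the value function ([value_le_tdp_forms]). All this
    holds for arbitrary trial points.

    It remains to see that almost surely the infimum of all forms is not
    strictly above the value function. Randomness enters through one property
    only: almost surely, at each time, the trial points return infinitely often
    to every neighbourhood of every point of the sphere ([iid_recurrent]). This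
    is the second Borel-Cantelli lemma, as the uniform measure charges every
    ball centered on the sphere ([uniform_full_support]). Given recurrence, a
    backward induction on time concludes ([tdp_forms_approach]): a nearly
    optimal switch and control at [y], followed by a nearly optimal form of the
    next time, give a one-step cost that is continuous in the state. Every form
    added later is the best possible at its trial point, hence, by homogeneity,
    along the line through this point; and such a line passes arbitrarily close
    to [y]. *)

Import Order.TTheory GRing.Theory Num.Theory.
Import numFieldNormedType.Exports.

Local Open Scope classical_set_scope.
Local Open Scope ring_scope.

(** * Quadratic forms and their equicontinuity *)

Lemma cvg_sum {R : realType} {J : finType} {T : Type} (F : set_system T)
    {FF : Filter F} (f : J -> T -> R) (l : J -> R) :
  (forall i, f i y @[y --> F] --> l i) ->
  (\sum_i f i y) @[y --> F] --> \sum_i l i.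
Proof.
by move=> fl; apply: cvg_big => //; exact: (@add_continuous R).
Qed.

Section QuadraticFormTheory.
Context {R : realType} {n : nat}.
Implicit Types (M N : 'M[R]_n) (x y z : 'cV[R]_n).

Definition bform M x y : R := (x^T *m M *m y) ord0 ord0.

Lemma bformE M x y :
  bform M x y = \sum_i \sum_j x i ord0 * M i j * y j ord0.
Proof.
rewrite /bform mxE exchange_big /=; apply: eq_bigr => j _.
by rewrite !mxE mulr_suml; apply: eq_bigr => i _; rewrite !mxE.
Qed.

Lemma qform_bform M x : qform M x = bform M x x. Proof. by []. Qed.

Lemma bform_sym M x y : M^T = M -> bform M x y = bform M y x.
Proof.
move=> sM; rewrite /bform -[in LHS](trmxK (_ *m y)) mxE.
by rewrite !trmx_mul trmxK sM mulmxA.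
Qed.

Lemma qformD M x y : M^T = M ->
  qform M (x + y) = qform M x + 2 * bform M x y + qform M y.
Proof.
move=> sM; rewrite !qform_bform.
have -> : bform M (x + y) (x + y) =
    bform M x x + bform M x y + (bform M y x + bform M y y).
  by rewrite /bform [(x + y)^T]linearD /= !mulmxDl !mulmxDr !mxE; ring.
by rewrite (bform_sym _ y x sM); ring.
Qed.

Lemma qformZ M (r : R) x : qform M (r *: x) = r ^+ 2 * qform M x.
Proof.
rewrite /qform [(r *: x)^T]linearZ /= -!scalemxAl -scalemxAr !mxE.
by rewrite expr2 mulrA.
Qed.

Lemma bformNr M x y : bform M x (- y) = - bform M x y.
Proof. by rewrite /bform mulmxN mxE. Qed.

Lemma qformN M x : qform M (- x) = qform M x.
Proof. by rewrite -scaleN1r qformZ sqrrN expr1n mul1r. Qed.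

Lemma qform0 M : qform M 0 = 0.
Proof. by rewrite /qform mulmx0 mxE. Qed.

Lemma qformDl M N x : qform (M + N) x = qform M x + qform N x.
Proof. by rewrite /qform mulmxDr mulmxDl !mxE. Qed.

Lemma qformBl M N x : qform (M - N) x = qform M x - qform N x.
Proof. by rewrite /qform mulmxBr mulmxBl !mxE. Qed.

Lemma qform_congr {p} (M : 'M[R]_p) (A : 'M[R]_(p, n)) x :
  qform (A^T *m M *m A) x = qform M (A *m x).
Proof. by rewrite /qform trmx_mul !mulmxA. Qed.

(** The norm [`|x|] on matrices is the sup norm, which neither defines the
    sphere nor is invariant under rotations. *)
Definition sqnorm x : R := \sum_i x i ord0 ^+ 2.

Lemma sqnorm_ge0 x : 0 <= sqnorm x.
Proof. by apply: sumr_ge0 => i _; exact: sqr_ge0. Qed.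

Lemma sqnormE x : sqnorm x = (x^T *m x) ord0 ord0.
Proof. by rewrite mxE; apply: eq_bigr => i _; rewrite !mxE expr2. Qed.

Lemma sqnorm_qform x : sqnorm x = qform 1%:M x.
Proof. by rewrite /qform mulmx1 sqnormE. Qed.

Lemma ler_sqr_sqnorm x i : x i ord0 ^+ 2 <= sqnorm x.
Proof.
rewrite /sqnorm (bigD1 i) //= lerDl.
by apply: sumr_ge0 => j _; exact: sqr_ge0.
Qed.

Lemma sqnormZ (r : R) x : sqnorm (r *: x) = r ^+ 2 * sqnorm x.
Proof. by rewrite !sqnorm_qform qformZ. Qed.

Lemma sqnorm_eq0 x : (sqnorm x == 0) = (x == 0).
Proof.
apply/idP/eqP => [|->]; last first.
  by rewrite /sqnorm big1// => i _; rewrite mxE expr0n.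
rewrite psumr_eq0 => [/allP h|i _]; last exact: sqr_ge0.
apply/matrixP => i j; rewrite ord1 mxE; apply/eqP.
by have := h i (mem_index_enum i); rewrite sqrf_eq0.
Qed.

Lemma norm_mul_coord_le x i j : `|x i ord0 * x j ord0| <= sqnorm x.
Proof.
have hi := ler_sqr_sqnorm x i; have hj := ler_sqr_sqnorm x j.
have h1 := sqr_ge0 (x i ord0 - x j ord0).
have h2 := sqr_ge0 (x i ord0 + x j ord0).
rewrite ler_norml; apply/andP; split; nra.
Qed.

Lemma qform_le_sqnorm M x :
  qform M x <= (\sum_i \sum_j `|M i j|) * sqnorm x.
Proof.
rewrite qform_bform bformE mulr_suml; apply: ler_sum => i _.
rewrite mulr_suml; apply: ler_sum => j _.
rewrite (le_trans (ler_norm _))// mulrAC mulrC normrM.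
by apply: ler_wpM2l => //; exact: norm_mul_coord_le.
Qed.

Lemma bform_delta M i j : bform M (delta_mx i ord0) (delta_mx j ord0) = M i j.
Proof.
rewrite bformE (bigD1 i)//= (bigD1 j)//= !mxE !eqxx !mul1r mulr1.
rewrite !big1 ?addr0// => k kN.
  by rewrite big1// => l _; rewrite mxE (negbTE kN) !mul0r.
by rewrite mxE (negbTE kN) mulr0.
Qed.

Lemma qform_delta M i : qform M (delta_mx i ord0) = M i i.
Proof. exact: bform_delta. Qed.

Lemma sqnorm_delta i : sqnorm (delta_mx i ord0) = 1.
Proof. by rewrite sqnorm_qform qform_delta mxE eqxx. Qed.

(** Test the form on the basis vectors and on their sums and differences. *)
Lemma entry_le (a : R) M i j : sympsd M ->
  (forall x, qform M x <= a * sqnorm x) -> `|M i j| <= a.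
Proof.
move=> [sM M0] Ma.
have hd k : M k k <= a.
  by rewrite -qform_delta (le_trans (Ma _))// sqnorm_delta mulr1.
have hi := hd i; have hj := hd j.
have := M0 (delta_mx i ord0 + delta_mx j ord0).
have := M0 (delta_mx i ord0 - delta_mx j ord0).
rewrite !qformD// qformN bformNr !qform_delta bform_delta.
by move=> h1 h2; rewrite ler_norml; apply/andP; split; lra.
Qed.

Lemma coord_cvg (z : 'cV[R]_n) i :
  (fun y : 'cV[R]_n => y i ord0) y @[y --> z] --> z i ord0.
Proof. exact: coord_continuous. Qed.

Lemma continuous_sqnorm_sub (c : 'cV[R]_n) :
  continuous (fun z : 'cV[R]_n => sqnorm (z - c)).
Proof.
move=> z; apply: (@cvg_sum _ _ _ (nbhs z)) => i.
under eq_fun do rewrite !mxE expr2.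
rewrite !mxE expr2; apply: cvgM; apply: cvgB (cvg_cst _); exact: coord_cvg.
Qed.

Lemma continuous_qform M : continuous (qform M).
Proof.
have -> : qform M = fun x => \sum_i \sum_j x i ord0 * M i j * x j ord0.
  by apply/funext => x; rewrite qform_bform bformE.
move=> z; apply: (@cvg_sum _ _ _ (nbhs z)) => i.
apply: (@cvg_sum _ _ _ (nbhs z)) => j.
by apply: cvgM (coord_cvg _ _); apply: cvgM (cvg_cst _); exact: coord_cvg.
Qed.

(** A Loewner upper bound on semidefinite matrices bounds all their entries,
    so one modulus of continuity serves all of them. *)
Lemma qform_equicontinuous (a e : R) (y : 'cV[R]_n) : 0 < e ->
  \forall z \near y, forall M, sympsd M ->
    (forall x, qform M x <= a * sqnorm x) -> `|qform M z - qform M y| < e.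
Proof.
move=> e0.
pose g z : R :=
  \sum_i \sum_j `|a| * `|z i ord0 * z j ord0 - y i ord0 * y j ord0|.
have gc : g z @[z --> y] --> g y.
  apply: (@cvg_sum _ _ _ (nbhs y)) => i; apply: (@cvg_sum _ _ _ (nbhs y)) => j.
  apply: cvgM (cvg_cst _) _; apply: cvg_norm; apply: cvgB (cvg_cst _).
  by apply: cvgM; exact: coord_cvg.
have gy : g y = 0.
  by apply: big1 => i _; apply: big1 => j _; rewrite subrr normr0 mulr0.
have : \forall z \near y, g z < e.
  by apply: (cvgr_lt _ gc); rewrite gy.
apply: filterS => z gz M psdM Ma; apply: le_lt_trans gz.
rewrite !qform_bform !bformE -sumrB (le_trans (ler_norm_sum _ _ _))//.
apply: ler_sum => i _; rewrite -sumrB (le_trans (ler_norm_sum _ _ _))//.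
apply: ler_sum => j _.
have -> : z i ord0 * M i j * z j ord0 - y i ord0 * M i j * y j ord0 =
  M i j * (z i ord0 * z j ord0 - y i ord0 * y j ord0) by ring.
rewrite normrM; apply: ler_wpM2r => //.
by rewrite (le_trans (entry_le _ _ i j psdM Ma))// ler_norm.
Qed.

Lemma nbhs_sqnorm_ball (z : 'cV[R]_n) (A : set 'cV[R]_n) : nbhs z A ->
  exists2 e : R, 0 < e & forall y, sqnorm (y - z) < e -> A y.
Proof.
move=> /nbhs_ballP[e /= e0 eA]; exists (e ^+ 2); first exact: exprn_gt0.
move=> y yz; apply: eA; split=> // i j; rewrite ord1 /ball /=.
have := le_lt_trans (ler_sqr_sqnorm (y - z) i) yz.
rewrite !mxE => h; have e1 := ltW e0.
by rewrite -(@ltr_pXn2r _ 2)// ?nnegrE// real_normK ?num_real// -sqrrN opprB.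
Qed.

Lemma sqnorm_ball_nbhs (z : 'cV[R]_n) (e : R) : 0 < e ->
  \forall y \near z, sqnorm (y - z) < e.
Proof.
move=> e0; apply: (cvgr_lt _ (continuous_sqnorm_sub z z)).
by rewrite subrr sqnorm_qform qform0.
Qed.

Lemma open_sqnorm_ball (c : 'cV[R]_n) (e : R) :
  open [set z : 'cV[R]_n | sqnorm (z - c) < e].
Proof.
rewrite (_ : mkset _ = (fun z => sqnorm (z - c)) @^-1` [set r | r < e])//.
by apply: open_comp => // z _; exact: continuous_sqnorm_sub.
Qed.

(** A closed subset of the cube, which is compact by Tychonoff. *)
Lemma compact_sphere : compact (sphere R n).
Proof.
have cK : compact [set v : 'rV[R]_n | forall i, v ord0 i \in `[(-1), 1]].
  apply: (@rV_compact _ _ (fun=> `[(-1 : R), 1]%classic)) => i.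
  exact: segment_compact.
have ctr : continuous (trmx : 'rV[R]_n -> 'cV[R]_n).
  move=> v A [P vP PA]; exists (fun i j => P j i) => [i j|w wP].
    by have := vP j i; rewrite mxE.
  by apply: PA => i j; rewrite mxE; exact: wP.
apply: (subclosed_compact _ (continuous_compact (continuous_subspaceT ctr) cK)).
  have -> : sphere R n = (fun z => sqnorm (z - 0)) @^-1` [set 1].
    by apply/seteqP; split=> z; rewrite /sphere /= subr0.
  apply: (@preimage_closed _ _ _ [set r : R | r = 1]) => [z _|].
    exact: continuous_sqnorm_sub.
  exact: closed_eq.
move=> x sx; exists x^T; last by rewrite trmxK.
move=> i /=; have := ler_sqr_sqnorm x i; rewrite /sqnorm sx mxE in_itv /=.
move=> x1; apply/andP; split; nra.
Qed.

End QuadraticFormTheory.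

(** * The Bellman operator on quadratic forms *)

Section PartialMinimization.
Context {R : realType} {n m : nat}.

Lemma sympd_unitmx (N : 'M[R]_m) : sympd N -> N \in unitmx.
Proof.
move=> [_ N0]; rewrite -row_free_unit; apply: inj_row_free => v vN.
apply/eqP/negPn/negP => v0; have := N0 v^T; rewrite trmx_eq0 => /(_ v0).
by rewrite /qform trmxK vN mul0mx mxE ltxx.
Qed.

Lemma sympd_psd (N : 'M[R]_m) : sympd N -> sympsd N.
Proof.
move=> [sN N0]; split=> // x; have [->|/N0/ltW//] := eqVneq x 0.
by rewrite qform0.
Qed.

Lemma trmx_congr (N : 'M[R]_m) (G : 'M[R]_(m, n)) : N^T = N ->
  (G^T *m N *m G)^T = G^T *m N *m G.
Proof. by move=> sN; rewrite !trmx_mul trmxK sN !mulmxA. Qed.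

(** A jointly quadratic cost that is strictly convex in [u] is minimized over
    [u] at [- invmx N *m (G *m x)]; what remains is the Schur complement. *)
Lemma complete_square (S : 'M[R]_n) (G : 'M[R]_(m, n)) (N : 'M[R]_m) :
  sympd N -> forall x u,
  qform S x + 2 * (u^T *m (G *m x)) ord0 ord0 + qform N u =
  qform (S - G^T *m invmx N *m G) x + qform N (u + invmx N *m (G *m x)).
Proof.
move=> pdN x u; have uN := sympd_unitmx N pdN; have [sN _] := pdN.
rewrite qformD// qformBl qform_congr; set w := G *m x.
have -> : bform N u (invmx N *m w) = (u^T *m w) ord0 ord0.
  by rewrite /bform mulmxA -mulmxA -mulmxA mulKVmx.
have -> : qform N (invmx N *m w) = qform (invmx N) w.
  rewrite -qform_congr trmx_inv sN.
  by rewrite mulVmx// mul1mx.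
ring.
Qed.

End PartialMinimization.

Section BellmanOperator.
Context {R : realType} {n m : nat} {V I : finType}.
Variable pb : switched_lq R n m V I.
Notation T := (horizon pb).
Local Notation pqf M := (fun x => (qform M x)%:E).

(** The infimum over controls is attained, so the Schur complement is itself
    nonnegative, being a value of the cost. *)
Lemma bellman_pqf t v (M : 'M[R]_n) : (t < T)%N -> sympsd M ->
  exists2 M', sympsd M' & bellman pb t v (pqf M) = pqf M'.
Proof.
move=> tT [sM M0].
have [sC C0] := costC_psd v tT; have pdD := costD_pd v tT.
have [sD D0] := sympd_psd _ pdD.
set A := dynA pb t v; set B := dynB pb t v.
set C := costC pb t v in sC C0; set D := costD pb t v in pdD sD D0.
pose N := D + B^T *m M *m B; pose G := B^T *m M *m A.
pose S := C + A^T *m M *m A.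
have pdN : sympd N.
  split; first by rewrite [(D + _)^T]linearD /= trmx_congr// sD.
  move=> u u0; rewrite qformDl qform_congr ltr_pwDl//; exact: pdD.2.
have sS : S^T = S.
  by rewrite [(C + _)^T]linearD /= trmx_congr// sC.
pose M' := S - G^T *m invmx N *m G.
have costE x u : cost pb t v x u + qform M (dyn pb t v x u) =
    qform M' x + qform N (u + invmx N *m (G *m x)).
  rewrite -complete_square// /cost /dyn -/A -/B -/C -/D qformD//.
  rewrite !qformDl !qform_congr (bform_sym _ _ _ sM).
  by rewrite {1}/bform trmx_mul !mulmxA; ring.
have sM' : M'^T = M'.
  by rewrite [(S - _)^T]linearB /= sS trmx_congr// trmx_inv pdN.1.
have M'E x : qform M' x = cost pb t v x (- (invmx N *m (G *m x))) +
    qform M (dyn pb t v x (- (invmx N *m (G *m x)))).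
  by rewrite costE addNr qform0 addr0.
exists M'.
  split=> // x; rewrite M'E addr_ge0// /cost addr_ge0//.
apply/funext => x; apply/eqP; rewrite eq_le; apply/andP; split.
  apply: ereal_inf_lbound; exists (- (invmx N *m (G *m x))) => //.
  by rewrite -EFinD M'E.
apply/ereal_infP => _ [u _ <-]; rewrite -EFinD lee_fin costE lerDl.
exact: (sympd_psd _ pdN).2.
Qed.

(** Forms [M] with [0 <= M <= a Id] in the Loewner order: the algorithm only
    ever creates forms of this kind, with [a] depending on the time alone. *)
Definition bounded_pqf (a : R) : set ('cV[R]_n -> \bar R) :=
  [set phi | exists M, [/\ sympsd M, forall x, qform M x <= a * sqnorm x &
                           phi = pqf M]].

Lemma bounded_pqf_convex a : bounded_pqf a `<=` convex_pqf.
Proof. by move=> phi [M [M0 _ ->]]; exists M. Qed.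

(** Bound the infimum by the cost of the control [u = 0]. *)
Lemma bellman_bounded_pqf t (a : R) : (t < T)%N -> 0 <= a ->
  exists2 b : R, 0 <= b &
    forall v phi, bounded_pqf a phi -> bounded_pqf b (bellman pb t v phi).
Proof.
move=> tT a0.
pose l (N : 'M[R]_n) := \sum_i \sum_j `|N i j|.
have l0 N : 0 <= l N by apply: sumr_ge0 => i _; apply: sumr_ge0.
pose b v := l (costC pb t v) + a * l ((dynA pb t v)^T *m dynA pb t v).
have b0 v : 0 <= b v by rewrite addr_ge0// mulr_ge0.
exists (\sum_v b v); first exact: sumr_ge0.
move=> v _ [M [psdM Ma ->]].
have [M' psdM' bE] := bellman_pqf t v M tT psdM.
exists M'; split=> // x; apply: (@le_trans _ _ (b v * sqnorm x)); last first.
  by rewrite ler_wpM2r ?sqnorm_ge0// (bigD1 v)//= lerDl sumr_ge0.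
rewrite -lee_fin -[(qform M' x)%:E]/(pqf M' x) -bE.
apply: ge_ereal_inf; exists ((cost pb t v x 0)%:E + pqf M (dyn pb t v x 0))%E.
  by exists 0.
rewrite -EFinD lee_fin /cost /dyn mulmx0 addr0 qform0 addr0.
rewrite mulrDl lerD ?qform_le_sqnorm// (le_trans (Ma _))// -mulrA.
rewrite ler_wpM2l// sqnorm_qform -qform_congr mulmx1.
exact: qform_le_sqnorm.
Qed.

Lemma bellman_le t v (phi psi : 'cV[R]_n -> \bar R) x :
  (forall y, phi y <= psi y)%E ->
  (bellman pb t v phi x <= bellman pb t v psi x)%E.
Proof.
move=> le; apply/ereal_infP => _ [u _ <-].
apply: ge_ereal_inf; exists ((cost pb t v x u)%:E + phi (dyn pb t v x u))%E.
  by exists u.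
exact: leeD2l.
Qed.

(** By homogeneity, a form that is optimal at a trial point is optimal along
    the whole line through it; this lets draws on the sphere control the value
    functions on the whole space, where the dynamics leads. *)
Lemma pqf_le_scale (phi psi : 'cV[R]_n -> \bar R) (r : R) x :
  convex_pqf phi -> convex_pqf psi ->
  (phi x <= psi x)%E -> (phi (r *: x) <= psi (r *: x))%E.
Proof.
move=> [M _ ->] [N _ ->]; rewrite !lee_fin !qformZ.
by move=> le; rewrite ler_wpM2l ?sqr_ge0.
Qed.

End BellmanOperator.
Arguments bounded_pqf {R n} a.

(** * The forms generated by the algorithm *)

Section Forms.
Context {R : realType} {n m : nat} {V I : finType}.
Variable pb : switched_lq R n m V I.
Notation T := (horizon pb).
Variable sel :
  nat -> set ('cV[R]_n -> \bar R) -> 'cV[R]_n -> ('cV[R]_n -> \bar R).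
Hypothesis hsel : minplus_selection pb sel.
Implicit Types x : nat -> nat -> 'cV[R]_n.
Local Notation F := (tdp_forms pb sel).

Lemma tdp_formsS x k t : (t <= T)%N ->
  exists phi, F x k.+1 t = F x k t `|` [set phi].
Proof.
rewrite leq_eqVlt => /predU1P[->|tT].
  by rewrite tdp_forms_final; eexists.
by rewrite tdp_forms_step//; eexists.
Qed.

Lemma tdp_forms_mono x k k' t : (t <= T)%N -> (k <= k')%N ->
  F x k t `<=` F x k' t.
Proof.
move=> tT; elim: k' => [|k' IH]; first by rewrite leqn0 => /eqP ->.
rewrite leq_eqVlt => /predU1P[->//|kk'].
by have [phi ->] := tdp_formsS x k' t tT; apply: subset_trans (IH kk') _; left.
Qed.

Lemma tdp_forms_finite x k t : (t <= T)%N -> finite_set (F x k t).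
Proof.
move=> tT; elim: k => [|k IH]; first exact: finite_set0.
have [phi ->] := tdp_formsS x k t tT.
by rewrite finite_setU; split => //; exact: finite_set1.
Qed.

Lemma tdp_forms_nonempty x k t : (t <= T)%N -> F x k.+1 t !=set0.
Proof.
by move=> tT; have [phi ->] := tdp_formsS x k t tT; exists phi; right.
Qed.

Lemma final_form_bounded i : bounded_pqf (alpha pb) (final_form pb i).
Proof.
have [_ h0] := finalM_ge0 pb i; have [_ h1] := finalM_le pb i.
exists (finalM pb i); split=> //.
  by split=> [|x]; [exact: finalM_sym|have := h0 x; rewrite subr0].
move=> x; have := h1 x; rewrite qformBl subr_ge0 => /le_trans; apply.
by rewrite /qform mul_mx_scalar -scalemxAl mxE sqnormE.
Qed.

(** Backward induction on time, where each step applies the Bellman operator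
    once: this is why the bound does not deteriorate with the iterations. *)
Lemma tdp_forms_bounded t : (t <= T)%N ->
  exists2 a : R, 0 <= a & forall x k, F x k t `<=` bounded_pqf a.
Proof.
move: {2}(T - t)%N (erefl (T - t)%N) => s; elim: s t => [|s IH] t ts tT.
  have -> : t = T by apply/eqP; rewrite eqn_leq tT /= -subn_eq0 ts.
  exists (alpha pb); first exact: alpha_ge0.
  move=> x; elim=> [|k IHk] phi; first by [].
  rewrite tdp_forms_final => -[/IHk//|->].
  have [|//|i [-> _]] := hsel.2 (F x k T) (x k T).
  - exact: tdp_forms_finite.
  - by apply: subset_trans IHk _; exact: bounded_pqf_convex.
  exact: final_form_bounded.
have tT' : (t < T)%N by rewrite -subn_gt0 ts.
have [|a a0 ha] := IH t.+1 _ tT'; first by rewrite subnS ts.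
have [b b0 hb] := bellman_bounded_pqf pb t a tT' a0.
exists b => // x; elim=> [|k IHk] phi; first by [].
rewrite tdp_forms_step// => -[/IHk//|->].
have [||//|v [psi [Fpsi -> _]]] := hsel.1 t (F x k.+1 t.+1) (x k t) tT'.
- exact: tdp_forms_finite.
- exact: tdp_forms_nonempty.
- by apply: subset_trans (ha _ _) _; exact: bounded_pqf_convex.
by apply: hb; exact: ha Fpsi.
Qed.

Lemma tdp_forms_convex x k t : (t <= T)%N -> F x k t `<=` convex_pqf.
Proof.
move=> /tdp_forms_bounded[a _ ha].
by apply: subset_trans (ha _ _) _; exact: bounded_pqf_convex.
Qed.

(** The factor [r] records that the new form is optimal along the whole line
    through the trial point, by [pqf_le_scale]. *)
Lemma tdp_new_form_final x k : exists i,
  F x k.+1 T = F x k T `|` [set final_form pb i] /\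
  forall i' (r : R),
    (final_form pb i (r *: x k T) <= final_form pb i' (r *: x k T))%E.
Proof.
have [||i [selE imin]] := hsel.2 (F x k T) (x k T).
- exact: tdp_forms_finite.
- exact: tdp_forms_convex.
exists i; split; first by rewrite tdp_forms_final selE.
move=> i' r; apply: pqf_le_scale (imin i').
- exact/bounded_pqf_convex/final_form_bounded.
- exact/bounded_pqf_convex/final_form_bounded.
Qed.

Lemma tdp_new_form x k t : (t < T)%N -> exists v psi,
  [/\ F x k.+1 t.+1 psi,
      F x k.+1 t = F x k t `|` [set bellman pb t v psi] &
      forall v' psi' (r : R), F x k.+1 t.+1 psi' ->
        (bellman pb t v psi (r *: x k t) <=
         bellman pb t v' psi' (r *: x k t))%E].
Proof.
move=> tT.
have [|||v [psi [Fpsi selE vmin]]] := hsel.1 t (F x k.+1 t.+1) (x k t) tT.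
- exact: tdp_forms_finite.
- exact: tdp_forms_nonempty.
- exact: tdp_forms_convex.
have pqfB v' psi' : F x k.+1 t.+1 psi' -> convex_pqf (bellman pb t v' psi').
  move=> /(tdp_forms_convex _ _ _ tT)[M psdM ->].
  by have [M' ? ->] := bellman_pqf pb t v' M tT psdM; exists M'.
exists v, psi; split=> //; first by rewrite tdp_forms_step// selE.
move=> v' psi' r Fpsi'; apply: pqf_le_scale (vmin v' psi' Fpsi'); exact: pqfB.
Qed.

(** Monotonicity of the Bellman operators propagates the bound backwards in
    time. *)
Lemma value_le_tdp_forms x k t phi y : (t <= T)%N -> F x k t phi ->
  (value pb t y <= phi y)%E.
Proof.
move: {2}(T - t)%N (erefl (T - t)%N) => s.
elim: s t k phi y => [|s IH] t k phi y ts tT.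
  have -> : t = T by apply/eqP; rewrite eqn_leq tT /= -subn_eq0 ts.
  elim: k => [//|k IHk].
  have [i [-> _]] := tdp_new_form_final x k => -[/IHk//|->].
  by rewrite value_final; apply: ereal_inf_lbound; exists i.
have tT' : (t < T)%N by rewrite -subn_gt0 ts.
elim: k => [//|k IHk].
have [v [psi [Fpsi -> _]]] := tdp_new_form x k t tT' => -[/IHk//|->].
rewrite value_step//; apply: ge_ereal_inf.
exists (bellman pb t v (value pb t.+1) y); first by exists v.
apply: bellman_le => z; apply: IH Fpsi => //.
by rewrite subnS ts.
Qed.

End Forms.

(** * Convergence along recurrent trial points *)

Section Envelope.
Context {R : realType} {n : nat}.
Implicit Types (G : set ('cV[R]_n -> \bar R)) (y : 'cV[R]_n).

Definition envelope G y : \bar R := ereal_inf [set phi y | phi in G].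

Lemma envelope_fin_num (a : R) G y : G `<=` bounded_pqf a -> G !=set0 ->
  envelope G y \is a fin_num.
Proof.
move=> Ga [phi Gphi]; rewrite ge0_fin_numE.
  have [M [_ _ phiE]] := Ga _ Gphi.
  apply: (@le_lt_trans _ _ (phi y)); last by rewrite phiE ltry.
  by apply: ereal_inf_lbound; exists phi.
apply/ereal_infP => _ [psi Gpsi <-].
by have [M [[_ M0] _ ->]] := Ga _ Gpsi; rewrite lee_fin.
Qed.

Lemma bounded_pqf_equicontinuous (a e : R) y : 0 < e ->
  \forall z \near y, forall phi, bounded_pqf a phi ->
    (phi z < phi y + e%:E)%E /\ (phi y < phi z + e%:E)%E.
Proof.
move=> e0; apply: filterS (qform_equicontinuous a e y e0) => z h phi.
move=> [M [psdM Ma ->]]; have := h M psdM Ma.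
by rewrite ltr_norml -!EFinD !lte_fin => /andP[? ?]; split; lra.
Qed.

(** A Dini argument. Near a point [y], one form [phi] already brings the
    infimum within [e / 3] of its limit; equicontinuity costs [e / 3] for [phi]
    and [e / 3] for the limit, and compactness makes the rank uniform. *)
Lemma cvg_uniformly_envelope (a : R) (F : nat -> set ('cV[R]_n -> \bar R))
    (K : set 'cV[R]_n) :
  compact K -> (forall k k', (k <= k')%N -> F k `<=` F k') ->
  (forall k, F k `<=` bounded_pqf a) -> (exists k, F k !=set0) ->
  cvg_uniformly_on K (fun k => envelope (F k))
    (fun y => fine (envelope (\bigcup_k F k) y)).
Proof.
move=> cK Fmono Fa [k0 [phi0 Fphi0]] e e0.
set G := \bigcup_k F k.
have Ga : G `<=` bounded_pqf a by move=> phi [k _ /Fa].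
have Gfin y : (fine (envelope G y))%:E = envelope G y.
  by rewrite fineK//; apply: (envelope_fin_num a) => //; exists phi0, k0.
have FG k y : (envelope G y <= envelope (F k) y)%E.
  by apply: ereal_inf_le_tmp => _ [phi Fphi <-]; exists phi => //; exists k.
suff : \forall k \near \oo,
    K `<=` [set y | envelope (F k) y < envelope G y + e%:E]%E.
  apply: filterS2 (nbhs_infty_ge k0) => k k0k Kk y /Kk /=.
  have Fkfin : envelope (F k) y \is a fin_num.
    apply: (envelope_fin_num a) => //; exists phi0; exact: Fmono Fphi0.
  have := FG k y; rewrite -Gfin -(fineK Fkfin) -EFinD lee_fin lte_fin => h1 h2.
  by rewrite -EFinB abse_EFin lte_fin ger0_norm; lra.
move/compact_near_coveringP: cK; apply => y Ky.
have e3 : 0 < e / 3 by rewrite divr_gt0.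
have /ereal_inf_ltP[_ [phi [k1 _ Fphi] <-] phiy] :
    (envelope G y < envelope G y + (e / 3)%:E)%E.
  by rewrite -Gfin -EFinD lte_fin ltrDl.
have [M [_ _ phiE]] := Fa _ _ Fphi.
exists ([set z | forall psi, bounded_pqf a psi ->
    (psi z < psi y + (e / 3)%:E)%E /\ (psi y < psi z + (e / 3)%:E)%E],
    [set k | (k1 <= k)%N]).
  by split; [exact: bounded_pqf_equicontinuous|exact: nbhs_infty_ge].
move=> [z k] /= [hz k1k].
apply: (@le_lt_trans _ _ (phi z)).
  by apply: ereal_inf_lbound; exists phi => //; exact: Fmono Fphi.
have yz : (envelope G y - (e / 3)%:E <= envelope G z)%E.
  apply/ereal_infP => _ [psi Gpsi <-]; have [_ /ltW] := hz _ (Ga _ Gpsi).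
  rewrite leeBlDr//; apply: le_trans.
  by apply: ereal_inf_lbound; exists psi.
have [h1 _] := hz _ (Fa _ _ Fphi); move: h1 phiy yz.
rewrite phiE -(Gfin y) -(Gfin z) -!EFinD !(lte_fin, lee_fin) => h1 h2 h3; lra.
Qed.

End Envelope.

Section Convergence.
Context {R : realType} {n m : nat} {V I : finType}.
Variable pb : switched_lq R n m V I.
Notation T := (horizon pb).
Variable sel :
  nat -> set ('cV[R]_n -> \bar R) -> 'cV[R]_n -> ('cV[R]_n -> \bar R).
Hypothesis hsel : minplus_selection pb sel.
Local Notation F := (tdp_forms pb sel).

(** The only property of the trial points that convergence to the value
    function needs. *)
Definition recurrent_on_sphere (p : nat -> 'cV[R]_n) :=
  forall s (e : R) k0, sphere R n s -> 0 < e ->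
  exists2 k, (k0 <= k)%N & sqnorm (p k - s) < e.

Lemma sphere_polar y : sphere R n !=set0 ->
  exists (r : R) s, sphere R n s /\ y = r *: s.
Proof.
move=> [s0 s0S]; have [->|y0] := eqVneq y 0.
  by exists 0, s0; rewrite scale0r.
have yn0 : sqnorm y != 0 by rewrite sqnorm_eq0.
pose r := Num.sqrt (sqnorm y).
have r2 : r ^+ 2 = sqnorm y by rewrite sqr_sqrtr ?sqnorm_ge0.
have r0 : r != 0 by rewrite -sqrf_eq0 r2.
exists r, (r^-1 *: y); split; last by rewrite scalerA divff// scale1r.
change (sqnorm (r^-1 *: y) = 1).
by rewrite sqnormZ exprVn r2 mulVf.
Qed.

(** If from rank [k0] on the form added at step [k] lies below a fixed
    continuous [g] along the line through [p k], then at every [y] some form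
    gets below any [b > g y]: choose [k] such that this line passes close to
    [y], and carry the inequality to [y] by equicontinuity. *)
Lemma recurrent_descent (a : R) (G : nat -> set ('cV[R]_n -> \bar R))
    (p : nat -> 'cV[R]_n) (g : 'cV[R]_n -> R) k0 y (b : R) :
  (forall k, G k `<=` bounded_pqf a) ->
  sphere R n !=set0 -> recurrent_on_sphere p ->
  {for y, continuous g} -> g y < b ->
  (forall k, (k0 <= k)%N -> exists2 phi, G k phi &
     forall r : R, (phi (r *: p k) <= (g (r *: p k))%:E)%E) ->
  exists k phi, G k phi /\ (phi y < b%:E)%E.
Proof.
move=> Ga S0 recp gc gyb opt.
have [r [s [sS yE]]] := sphere_polar y S0.
pose c := (g y + b) / 2.
have [gyc cb] : g y < c /\ c < b by rewrite /c; split; lra.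
have bc0 : 0 < b - c by rewrite subr_gt0.
have : \forall z \near y, g z < c /\ forall phi, bounded_pqf a phi ->
    (phi z < phi y + (b - c)%:E)%E /\ (phi y < phi z + (b - c)%:E)%E.
  apply: filterI; first exact: (cvgr_lt _ gc).
  exact: bounded_pqf_equicontinuous.
move=> /nbhs_sqnorm_ball[e e0 he].
(* scaling by [r] multiplies squared distances by [r ^+ 2], possibly zero *)
have r1 : 0 < r ^+ 2 + 1 by rewrite ltr_wpDl// sqr_ge0.
have [|k k0k pks] := recp s (e / (r ^+ 2 + 1)) k0 sS; first exact: divr_gt0.
have [phi Gphi phiopt] := opt k k0k; exists k, phi; split=> //.
have [|gc' hphi] := he (r *: p k).
  rewrite yE -scalerBr sqnormZ.
  move: pks; rewrite ltr_pdivlMr// => pks.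
  have := sqnorm_ge0 (p k - s); have := sqr_ge0 r; nra.
have [M [_ _ phiE]] := Ga _ _ Gphi.
have [_] := hphi _ (Ga _ _ Gphi); have := phiopt r.
by rewrite phiE -EFinD !(lee_fin, lte_fin) => h1 h2; lra.
Qed.

Lemma continuous_dyn_coord t v u i :
  continuous (fun z : 'cV[R]_n => dyn pb t v z u i ord0).
Proof.
have -> : (fun z => dyn pb t v z u i ord0) = fun z : 'cV[R]_n =>
    \sum_k dynA pb t v i k * z k ord0 + (dynB pb t v *m u) i ord0.
  by apply/funext => z; rewrite !mxE.
move=> z; apply: (@cvgD _ _ _ (nbhs z)); last exact: cvg_cst.
apply: (@cvg_sum _ _ _ (nbhs z)) => k.
apply: cvgM (cvg_cst _) _; exact: coord_cvg.
Qed.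

Lemma continuous_one_step t v (M : 'M[R]_n) u :
  continuous (fun z => cost pb t v z u + qform M (dyn pb t v z u)).
Proof.
have -> : (fun z => cost pb t v z u + qform M (dyn pb t v z u)) =
  (fun z : 'cV[R]_n => qform (costC pb t v) z + qform (costD pb t v) u +
     \sum_i \sum_j ((dyn pb t v z u) i ord0 * M i j * (dyn pb t v z u) j ord0)).
  by apply/funext => z; rewrite /cost [qform M _]qform_bform bformE.
move=> z; apply: (@cvgD _ _ _ (nbhs z)).
  apply: (@cvgD _ _ _ (nbhs z)); [exact: continuous_qform|exact: cvg_cst].
apply: (@cvg_sum _ _ _ (nbhs z)) => i.
apply: (@cvg_sum _ _ _ (nbhs z)) => j.
apply: cvgM; last exact: continuous_dyn_coord.
apply: cvgM (cvg_cst _); exact: continuous_dyn_coord.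
Qed.

(** Backward induction on time. If [value t y < b], some switch [v], control
    [u] and, by induction, form [psi] produced at time [t.+1] give a one-step
    cost below [b] at [y]. With [v], [u] and [psi] frozen, this cost is a
    continuous function of the state, and it competes with every form added
    later at time [t]. *)
Lemma tdp_forms_approach x t y (b : R) : sphere R n !=set0 ->
  (forall t', (t' <= T)%N -> recurrent_on_sphere (x ^~ t')) ->
  (t <= T)%N -> (value pb t y < b%:E)%E ->
  exists k phi, F x k t phi /\ (phi y < b%:E)%E.
Proof.
move=> S0 recx.
move: {2}(T - t)%N (erefl (T - t)%N) => s.
elim: s t y b => [|s IH] t y b ts tT.
  have -> : t = T by apply/eqP; rewrite eqn_leq tT /= -subn_eq0 ts.
  rewrite value_final => /ereal_inf_ltP[_ [i _ <-]]; rewrite lte_fin => ib.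
  have [a _ ha] := tdp_forms_bounded pb sel hsel T (leqnn T).
  have [|//||k [phi [Fphi phib]]] := recurrent_descent a (fun k => F x k.+1 T)
      (x ^~ T) (qform (finalM pb i)) 0 y b _ S0 (recx T (leqnn T)) _ ib.
  - by move=> k; exact: ha.
  - exact: continuous_qform.
  - move=> k _; have [i' [-> i'min]] := tdp_new_form_final pb sel hsel x k.
    by exists (final_form pb i') => [|r]; [right|exact: i'min].
  - by exists k.+1, phi.
have tT' : (t < T)%N by rewrite -subn_gt0 ts.
rewrite value_step// => /ereal_inf_ltP[_ [v _ <-]] /ereal_inf_ltP[_ [u _ <-]].
rewrite addeC -lteBrDr// -EFinB => vb.
have [||k0 [psi [Fpsi psib]]] := IH t.+1 (dyn pb t v y u) _ _ _ vb => //.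
  by rewrite subnS ts.
have [M psdM psiE] := tdp_forms_convex pb sel hsel x k0 t.+1 tT' psi Fpsi.
have [a _ ha] := tdp_forms_bounded pb sel hsel t tT.
have [||||k [phi [Fphi phib]]] := recurrent_descent a (fun k => F x k.+1 t)
    (x ^~ t) (fun z => cost pb t v z u + qform M (dyn pb t v z u)) k0 y b
    _ S0 (recx t tT).
- by move=> k; exact: ha.
- exact: continuous_one_step.
- by move: psib; rewrite psiE lte_fin; lra.
- move=> k k0k.
  have [v' [psi' [Fpsi' -> opt]]] := tdp_new_form pb sel hsel x k t tT'.
  exists (bellman pb t v' psi') => [|r]; first by right.
  have Fkpsi : F x k.+1 t.+1 psi.
    by apply: tdp_forms_mono Fpsi => //; exact: leqW.
  apply: le_trans (opt v psi r Fkpsi) _.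
  by apply: ereal_inf_lbound; exists u => //; rewrite psiE.
- by exists k.+1, phi.
Qed.

Lemma tdp_value_cvg x t : (t <= T)%N ->
  [/\ forall y, nonincreasing_seq (fun k => tdp_value pb sel x k t y),
      forall k y, (value pb t y <= tdp_value pb sel x k t y)%E &
      cvg_uniformly_on (sphere R n) (fun k y => tdp_value pb sel x k t y)
        (fun y => fine (envelope (\bigcup_k F x k t) y))].
Proof.
move=> tT; split.
- move=> y k k' kk'; apply: ereal_inf_le_tmp => _ [phi Fphi <-].
  by exists phi => //; exact: tdp_forms_mono Fphi.
- move=> k y; apply/ereal_infP => _ [phi Fphi <-].
  exact: value_le_tdp_forms Fphi.
have [a _ ha] := tdp_forms_bounded pb sel hsel t tT.
apply: (cvg_uniformly_envelope a) => //.
- exact: compact_sphere.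
- by move=> k k'; exact: tdp_forms_mono.
- by exists 1%N; exact: tdp_forms_nonempty.
Qed.

Lemma envelope_tdp_forms x t y : sphere R n !=set0 ->
  (forall t', (t' <= T)%N -> recurrent_on_sphere (x ^~ t')) ->
  (t <= T)%N ->
  (fine (envelope (\bigcup_k F x k t) y))%:E = value pb t y.
Proof.
move=> S0 recx tT.
have [a _ ha] := tdp_forms_bounded pb sel hsel t tT.
have Efin : envelope (\bigcup_k F x k t) y \is a fin_num.
  apply: (envelope_fin_num a) => [phi [k _ /ha]//|].
  by have [phi Fphi] := tdp_forms_nonempty pb sel x 0 t tT; exists phi, 1%N.
rewrite fineK//; apply/eqP; rewrite eq_le; apply/andP; split; last first.
  by apply/ereal_infP => _ [phi [k _ Fphi] <-]; exact: value_le_tdp_forms Fphi.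
rewrite leNgt -(fineK Efin); apply/negP => lt_value.
have [k [phi [Fphi]]] := tdp_forms_approach x t y _ S0 recx tT lt_value.
rewrite fineK// ltNge => /negP; apply.
by apply: ereal_inf_lbound; exists phi => //; exists k.
Qed.

End Convergence.

(** * The uniform measure on the sphere *)

Section UniformOnSphere.
Context {R : realType} {n : nat}.
Implicit Types (x y s c : 'cV[R]_n).

Definition eball c (e : R) : set 'cV[R]_n := [set x | sqnorm (x - c) < e].

Lemma measurable_open (E : set (borelX R n)) :
  open (E : set 'cV[R]_n) -> measurable E.
Proof. by move=> oE; apply: sub_sigma_algebra. Qed.

Lemma measurable_eball c e : measurable (eball c e : set (borelX R n)).
Proof. by apply: measurable_open; exact: open_sqnorm_ball. Qed.

Lemma measurable_sphere : measurable (sphere R n : set (borelX R n)).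
Proof.
rewrite -[sphere R n]setCK; apply: measurableC; apply: measurable_open.
apply: closed_openC; apply: compact_closed; last exact: compact_sphere.
exact: norm_hausdorff.
Qed.

Lemma sqnormD_le x y : sqnorm (x + y) <= 2 * sqnorm x + 2 * sqnorm y.
Proof.
have := sqnorm_ge0 (x - y).
by rewrite !sqnorm_qform !qformD ?trmx1// qformN bformNr => h; lra.
Qed.

(** The triangle inequality for squared distances, whence the factor 4. *)
Lemma eball_trans c s y (d e : R) :
  sqnorm (c - s) < d -> sqnorm (y - c) < d -> 4 * d <= e -> sqnorm (y - s) < e.
Proof.
move=> cs yc de; have -> : y - s = (y - c) + (c - s) by rewrite addrA subrK.
by have := sqnormD_le (y - c) (c - s); lra.
Qed.

Lemma sqnorm_sub_sym x y : sqnorm (x - y) = sqnorm (y - x).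
Proof. by rewrite !sqnorm_qform -opprB qformN. Qed.

Lemma orthogonal_sqnorm (Q : 'M[R]_n) x : Q^T *m Q = 1%:M ->
  sqnorm (Q *m x) = sqnorm x.
Proof. by move=> oQ; rewrite !sqnorm_qform -qform_congr mulmx1 oQ. Qed.

Lemma dot_mx11 x y : x^T *m y = ((x^T *m y) ord0 ord0)%:M.
Proof. by rewrite {1}[x^T *m y]mx11_scalar. Qed.

(** The Householder reflection along [s - s'] exchanges [s] and [s']. *)
Lemma sphere_transitive s s' : sphere R n s -> sphere R n s' ->
  exists2 Q : 'M[R]_n, Q^T *m Q = 1%:M & Q *m s' = s.
Proof.
move=> ss ss'; have [->|ss'N] := eqVneq s s'.
  by exists 1%:M; rewrite ?trmx1 mul1mx.
set v := s - s'; pose q := sqnorm v.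
have q0 : q != 0 by rewrite sqnorm_eq0 subr_eq0.
have s1 : sqnorm s = 1 by [].
have s'1 : sqnorm s' = 1 by [].
pose Q := 1%:M - (2 / q) *: (v *m v^T).
have QT : Q^T = Q.
  by rewrite linearB /= trmx1 linearZ /= trmx_mul trmxK.
exists Q.
  have vvvv : v *m v^T *m (v *m v^T) = q *: (v *m v^T).
    rewrite mulmxA -(mulmxA v) (dot_mx11 v v) -sqnormE -/q mul_mx_scalar.
    by rewrite -scalemxAl.
  rewrite QT /Q mulmxBl mul1mx mulmxBr mulmx1 -scalemxAl -scalemxAr vvvv.
  rewrite !scalerA -scalerBl (_ : 2 / q - _ = - (2 / q)); last by field.
  by rewrite scaleNr opprK subrK.
have vs' : (v^T *m s') ord0 ord0 = - (q / 2).
  have qE : q = sqnorm s - 2 * bform 1%:M s s' + sqnorm s'.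
    by rewrite /q /v !sqnorm_qform qformD ?trmx1// qformN bformNr mulrN.
  have -> : (v^T *m s') ord0 ord0 = bform 1%:M s s' - sqnorm s'.
    by rewrite /bform mulmx1 sqnormE /v [(s - s')^T]linearB /= mulmxBl !mxE.
  by rewrite qE s1 s'1; field.
rewrite mulmxBl mul1mx -scalemxAl -mulmxA (dot_mx11 v s') vs' mul_mx_scalar.
rewrite scalerA (_ : 2 / q * - (q / 2) = -1); last by field.
by rewrite scaleN1r opprK addrC subrK.
Qed.

(** Vectors with rational coordinates, enumerated. *)
Lemma countable_dense_cV : exists c : nat -> 'cV[R]_n,
  forall y (e : R), 0 < e -> exists i, sqnorm (c i - y) < e.
Proof.
exists (fun i => map_mx ratr (odflt 0 (unpickle i : option 'cV[rat]_n))).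
move=> y e e0; have /nbhs_ballP[d /= d0 dP] := sqnorm_ball_nbhs y e e0.
have /choice[q qP] i : exists r : rat, ball (y i ord0) d (ratr r : R).
  have [|r] := @rat_in_itvoo R (y i ord0) (y i ord0 + d).
    by rewrite ltrDl.
  rewrite in_itv /= => /andP[r1 r2]; exists r.
  by rewrite /ball /= ltr_norml; apply/andP; split; lra.
exists (pickle (\col_i q i)); rewrite pickleK /=.
apply: dP; split=> // i j; rewrite ord1 !mxE; exact: qP.
Qed.

Lemma uniform_eball (sigma : probability (borelX R n) R) s s' (e : R) :
  uniform_on_sphere sigma -> sphere R n s -> sphere R n s' ->
  sigma (eball s e) = sigma (eball s' e).
Proof.
move=> [_ inv] sS s'S; have [Q oQ Qs'] := sphere_transitive s s' sS s'S.
rewrite -(inv Q oQ _ (measurable_eball s e)); congr (sigma _).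
apply/seteqP; split=> z; rewrite /eball /=;
  by rewrite -{1}Qs' -mulmxBr orthogonal_sqnorm.
Qed.

Lemma uniform_sphere_nonempty (sigma : probability (borelX R n) R) :
  uniform_on_sphere sigma -> sphere R n !=set0.
Proof.
move=> [S1 _]; apply/set0P/eqP => S0.
by move: S1; rewrite S0 measure0 => /eqP; rewrite eq_sym onee_eq0.
Qed.

(** By rotation invariance, if one small ball were null then all balls of that
    radius centered on the sphere would be; countably many of their subsets
    cover the sphere, which would be null too. *)
Lemma uniform_full_support (sigma : probability (borelX R n) R) s (e : R) :
  uniform_on_sphere sigma -> sphere R n s -> 0 < e ->
  (0 < sigma (eball s e))%E.
Proof.
move=> usigma sS e0; rewrite lt_neqAle measure_ge0 andbT eq_sym.
apply/eqP => sig0; have [c cP] := countable_dense_cV.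
pose N i :=
  if sigma (eball (c i) (e / 4)) == 0%E then eball (c i) (e / 4) else set0.
have N0 i : sigma.-negligible (N i : set (borelX R n)).
  rewrite /N; case: eqP => [h|_]; last exact: negligible_set0.
  by apply/negligibleP => //; exact: measurable_eball.
have : sigma.-negligible (sphere R n : set (borelX R n)).
  apply: negligibleS (negligible_bigcup N0) => s' s'S.
  have [i ci] := cP s' (e / 4) (divr_gt0 e0 (ltr0Sn _ _)).
  exists i => //; rewrite /N; case: eqP => [_|[]].
    by rewrite /eball /= sqnorm_sub_sym.
  apply/eqP; rewrite -measure_le0 -sig0 (uniform_eball _ s s')//.
  apply: le_measure; rewrite ?inE; try exact: measurable_eball.
  by move=> z /= zc; apply: (eball_trans _ _ _ _ _ ci zc); lra.
move=> /(measure_negligible measurable_sphere) S0.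
have [S1 _] := usigma; have : 0%E = 1%E :> \bar R by rewrite -S1 -[LHS]S0.
by move=> /eqP; rewrite eq_sym onee_eq0.
Qed.

End UniformOnSphere.

(** * Recurrence of independent uniform draws *)

Section Recurrence.
Context {R : realType} {n T : nat}.
Context {d : measure_display} {Omega : measurableType d}.
Variables (P : probability Omega R) (sigma : probability (borelX R n) R).
Variable x : nat -> nat -> Omega -> 'cV[R]_n.
Hypothesis hx : iid_draws T P sigma x.

(** Independence bounds the probability of avoiding [E] during [N] steps by
    the [N]-th power of [sigma (~` E) < 1]. *)
Lemma iid_avoid t (E : set (borelX R n)) k0 : (t <= T)%N -> measurable E ->
  (0 < sigma E)%E ->
  P.-negligible (\bigcap_(k in [set k | (k0 <= k)%N]) (x k t @^-1` (~` E))).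
Proof.
move=> tT mE sE; have [mx xE indep] := hx.
have mC : measurable (~` E) by exact: measurableC.
have mxC k : measurable (x k t @^-1` (~` E)).
  by rewrite -[X in measurable X]setTI; exact: mx.
set B := \bigcap_(k in _) _.
have mB : measurable B.
  by apply: bigcap_measurableType => k _; exact: mxC.
apply/negligibleP => //.
pose q := fine (sigma (~` E)).
have qE : sigma (~` E) = q%:E by rewrite fineK// fin_num_measure.
have [q0 q1] : 0 <= q /\ q < 1.
  split; first by rewrite fine_ge0.
  rewrite -lte_fin -qE probability_setC//.
  by rewrite lteBlDr ?fin_num_measure// lteDl.
have le_pow N : (P B <= (q ^+ N)%:E)%E.
  pose j (i : nat) : nat * 'I_T.+1 := ((k0 + i)%N, inord t).
  have /= := indep (map j (iota 0 N)) (fun=> ~` E) _ (fun=> mC).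
  rewrite map_inj_uniq; last by move=> i i' [/addnI].
  move=> /(_ (iota_uniq 0 N)) PE.
  have -> : (q ^+ N)%:E =
      (\prod_(j <- map j (iota 0 N)) P (x j.1 j.2 @^-1` (~` E)))%E.
    rewrite big_map (eq_bigr (fun=> q%:E)); last first.
      by move=> i _ /=; rewrite inordK// xE.
    by rewrite prodEFin big_const_seq count_predT size_iota iter_mulr mulr1.
  rewrite -PE; apply: le_measure; rewrite ?inE//.
    apply: fin_bigcap_measurable => // -[k i] /= _.
    rewrite -[X in measurable X]setTI; apply: mx => //.
    by rewrite -ltnS.
  move=> w Bw ji /mapP[i _ ->] /=; rewrite inordK//.
  by apply: Bw => /=; exact: leq_addr.
apply/eqP; rewrite eq_le measure_ge0 andbT leNgt; apply/negP => PB0.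
have PBfin : P B \is a fin_num by rewrite fin_num_measure.
have : \forall N \near \oo, q ^+ N < fine (P B).
  apply: (cvgr_lt _ (cvg_expr _)); first by rewrite ger0_norm.
  by rewrite fine_gt0// PB0 -ge0_fin_numE.
move=> /filter_ex[N]; apply/negP; rewrite -leNgt -lee_fin fineK//.
Qed.

(** Second Borel-Cantelli lemma, applied to the countably many balls with
    rational centers and inverse integer squared radii, which suffice to test
    recurrence. *)
Lemma iid_recurrent : uniform_on_sphere sigma ->
  {ae P, forall w, forall t, (t <= T)%N ->
    recurrent_on_sphere (fun k => x k t w)}.
Proof.
move=> usigma; have [c cP] := @countable_dense_cV R n.
pose rball i j := eball (c i) (j.+1%:R^-1 : R).
pose bad t i j k0 : set Omega :=
  if (t <= T)%N && (0 < sigma (rball i j))%E then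
    \bigcap_(k in [set k | (k0 <= k)%N]) (x k t @^-1` (~` rball i j))
  else set0.
have : P.-negligible (\bigcup_t \bigcup_i \bigcup_j \bigcup_k0 bad t i j k0).
  apply: negligible_bigcup => t; apply: negligible_bigcup => i.
  apply: negligible_bigcup => j; apply: negligible_bigcup => k0.
  rewrite /bad; case: ifP => [/andP[tT pos]|_]; last exact: negligible_set0.
  by apply: iid_avoid => //; exact: measurable_eball.
apply: negligibleS => w /= nrec; apply: contrapT => nbad; apply: nrec => t tT.
move=> s e k0 sS e0.
have [j] := ltr_add_invr (divr_gt0 e0 (ltr0Sn _ 3)).
rewrite add0r => je; have j0 : 0 < j.+1%:R^-1 :> R by rewrite invr_gt0.
have [i ci] := cP s _ j0.
have pos : (0 < sigma (rball i j))%E.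
  have /nbhs_sqnorm_ball[e' e'0 sub] : nbhs s (rball i j).
    apply: open_nbhs_nbhs; split; first exact: open_sqnorm_ball.
    by rewrite /rball /eball /= sqnorm_sub_sym.
  apply: lt_le_trans (uniform_full_support sigma s e' usigma sS e'0) _.
  by apply: le_measure; rewrite ?inE; try exact: measurable_eball.
apply: contrapT => never; apply: nbad.
exists t => //; exists i => //; exists j => //; exists k0 => //.
rewrite /bad tT pos => k k0k; rewrite /= => xk.
apply: never; exists k => //; apply: (eball_trans _ _ _ _ _ ci xk).
by rewrite mulrC -ler_pdivlMr// ltW.
Qed.

End Recurrence.

(** * Almost sure convergence *)

Local Open Scope ereal_scope.

Theorem theorem30 (R : realType) (n m : nat) (V I : finType)
    (pb : switched_lq R n m V I)
    (sel : nat -> set ('cV[R]_n -> \bar R) -> 'cV[R]_n -> ('cV[R]_n -> \bar R))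
    (hsel : minplus_selection pb sel)
    (d : measure_display) (Omega : measurableType d) (P : probability Omega R)
    (sigma : probability (borelX R n) R)
    (hsigma : uniform_on_sphere sigma)
    (x : nat -> nat -> Omega -> 'cV[R]_n)
    (hx : iid_draws (horizon pb) P sigma x)
    (t : nat) (ht : (t <= horizon pb)%N) :
  let Vk := fun (w : Omega) (k : nat) (y : 'cV[R]_n) =>
    tdp_value pb sel (fun k' t' => x k' t' w) k t y in
  exists Vstar : Omega -> 'cV[R]_n -> R,
    (forall w : Omega,
       [/\ forall y, nonincreasing_seq (fun k => Vk w k y),
           forall k y, value pb t y <= Vk w k y &
           cvg_uniformly_on (sphere R n) (Vk w) (Vstar w)]) /\
    {ae P, forall w : Omega,
       forall y, sphere R n y -> (Vstar w y)%:E = value pb t y}.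
Proof.
move=> Vk; pose traj w := fun k' t' => x k' t' w.
exists (fun w y =>
  fine (envelope (\bigcup_k tdp_forms pb sel (traj w) k t) y)).
split=> [w|]; first exact: tdp_value_cvg.
apply: filterS (iid_recurrent P sigma x hx hsigma) => w rec y _.
apply: envelope_tdp_forms => //; exact: uniform_sphere_nonempty hsigma.
Qed.
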